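(* Let $G$ be a connected graph. For any vertex $u$ of $G$, $\chi_c(G)\ge \chi(N_1(u))+1$.
   Context: Graphs are finite, simple and undirected. For positive integers $k\ge 2d$, a $(k,d)$-coloring of $G$ is a map $f:V(G)\to\{0,1,\dots,k-1\}$ such that $d\le |f(x)-f(y)|\le k-d$ for every edge $xy$; $G$ is $(k,d)$-colorable if it has one. The circular chromatic number is $\chi_c(G)=\inf\{k/d: G\text{ is }(k,d)\text{-colorable}\}$. $N_1(u)$ is the set of vertices adjacent to $u$; $\chi(S)$ for $S\subseteq V(G)$ denotes the (ordinary) chromatic number of the subgraph of $G$ induced by $S$. *)

(* Defs.v *)
From mathcomp Require Import all_boot all_order all_algebra.
From mathcomp Require Import classical_sets reals.

Set Implicit Arguments.
Unset Strict Implicit.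
Unset Printing Implicit Defensive.

Import Order.TTheory GRing.Theory Num.Theory.
Local Open Scope ring_scope.

Record sgraph := SGraph {
  vertex :> finType;
  adj : rel vertex;
  adj_sym : symmetric adj;
  adj_irrefl : irreflexive adj }.

Definition connected_graph (G : sgraph) : Prop :=
  forall x y : G, connect (@adj G) x y.

Definition neighborhood (G : sgraph) (u : G) : {set G} := [set x | adj u x].

Definition induced_adj (G : sgraph) (S : {set G}) : rel {x : G | x \in S} :=
  fun x y => adj (val x) (val y).

Lemma induced_adj_sym (G : sgraph) (S : {set G}) :
  symmetric (@induced_adj G S).
Proof. by move=> x y; exact: adj_sym. Qed.

Lemma induced_adj_irrefl (G : sgraph) (S : {set G}) :
  irreflexive (@induced_adj G S).
Proof. by move=> x; exact: adj_irrefl. Qed.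

Definition induced (G : sgraph) (S : {set G}) : sgraph :=
  SGraph (@induced_adj_sym G S) (@induced_adj_irrefl G S).

Definition colorable (G : sgraph) (n : nat) : bool :=
  [exists f : {ffun G -> 'I_n}, forall x, forall y, adj x y ==> (f x != f y)].

Lemma colorable_exists (G : sgraph) : exists n, colorable G n.
Proof.
exists #|G|; apply/existsP; exists [ffun x => enum_rank x].
apply/forallP=> x; apply/forallP=> y; apply/implyP=> xy; rewrite !ffunE.
by apply: contraTneq xy => /enum_rank_inj ->; rewrite adj_irrefl.
Qed.

Definition chromatic_number (G : sgraph) : nat := ex_minn (colorable_exists G).

(* The distance is taken in int; the subtraction k - d is the one on nat,
   hence it is exact only for d <= k, which circular_ratios guarantees. *)
Definition kd_coloring (G : sgraph) (k d : nat) (f : G -> 'I_k) : Prop :=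
  forall x y : G, adj x y ->
    (d <= `|(f x)%:Z - (f y)%:Z| <= k - d)%N.

Definition kd_colorable (G : sgraph) (k d : nat) : Prop :=
  exists f : G -> 'I_k, kd_coloring d f.

Local Open Scope classical_set_scope.

Definition circular_ratios (R : realType) (G : sgraph) : set R :=
  [set r | exists k d : nat,
     [/\ (0 < d)%N, (2 * d <= k)%N, kd_colorable G k d & r = k%:R / d%:R]].
Arguments circular_ratios : clear implicits.

(* This set is nonempty and bounded below by 2, so that inf does not take its
   default value. *)
Definition circular_chromatic_number (R : realType) (G : sgraph) : R :=
  inf (circular_ratios R G).
Arguments circular_chromatic_number : clear implicits.

(* Main.v *)
Require Import Defs.
From mathcomp Require Import all_boot all_order all_algebra.
From mathcomp Require Import classical_sets reals.
From mathcomp Require Import zify.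
Set Implicit Arguments.
Unset Strict Implicit.
Unset Printing Implicit Defensive.
Import Order.TTheory GRing.Theory Num.Theory.
Local Open Scope ring_scope.

(** The [k] colors of a (k,d)-coloring sit on a circle, and the condition on
    edges says that adjacent vertices are at circular distance at least [d]. It
    is invariant under rotation, so [u] may be given color 0, which confines the
    colors of its neighbors to the interval [d, k - d]. This interval is
    covered by [k %/ d - 1] consecutive blocks of length [d], and two vertices
    in the same block are too close to be adjacent: the blocks properly color
    the neighborhood of [u] ([neighborhood_colorable]). Hence
    [chi (N u) + 1 <= k %/ d <= k / d] for every ratio [k / d] over which the
    infimum is taken. That set of ratios is nonempty
    ([circular_ratios_nonempty]), so the bound passes to its infimum. *)

Lemma chromatic_number_le (G : sgraph) (n : nat) :
  colorable G n -> (chromatic_number G <= n)%N.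
Proof. by rewrite /chromatic_number; case: ex_minnP => m _; apply. Qed.

(** The two bounds in [kd_coloring] are exchanged when exactly one of the two
    colors wraps around, since the difference [t] then becomes [k - t]. *)
Lemma kd_coloring_rotate (G : sgraph) (k d : nat) (u : G) :
  (d <= k)%N -> kd_colorable G k d ->
  exists2 g : G -> 'I_k, kd_coloring d g & g u = 0%N :> nat.
Proof.
move=> le_dk [f f_col].
pose r x := (if f u <= f x then f x - f u else f x + k - f u)%N.
have r_lt x : (r x < k)%N.
  by rewrite /r; have := ltn_ord (f x); have := ltn_ord (f u); case: ifP; lia.
exists (fun x => Ordinal (r_lt x)) => [x y /f_col|]; last first.
  by rewrite /= /r leqnn subnn.
rewrite /= /r; have := ltn_ord (f x); have := ltn_ord (f y).
by have := ltn_ord (f u); case: ifP; case: ifP; lia.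
Qed.

Lemma distn_lt_same_quotient (d a b : nat) :
  (0 < d)%N -> (a %/ d = b %/ d)%N -> (`|a%:Z - b%:Z| < d)%N.
Proof.
move=> d_gt0 eq_quo; have := ltn_pmod a d_gt0; have := ltn_pmod b d_gt0.
by have := divn_eq a d; have := divn_eq b d; rewrite eq_quo; lia.
Qed.

Lemma neighborhood_colorable (G : sgraph) (k d : nat) (u : G) :
  (0 < d)%N -> (2 * d <= k)%N -> kd_colorable G k d ->
  colorable (induced (neighborhood u)) (k %/ d).-1.
Proof.
move=> d_gt0 le_2dk Gkd.
have le_dk : (d <= k)%N by lia.
have [g g_col gu0] := kd_coloring_rotate u le_dk Gkd.
have g_nbr x : x \in neighborhood u -> (d <= g x <= k - d)%N.
  by rewrite inE => /g_col; rewrite gu0; lia.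
have block_lt (x : induced (neighborhood u)) :
    ((g (val x) - d) %/ d < (k %/ d).-1)%N.
  have /andP[_ gx_le] := g_nbr _ (valP x).
  have quo_gt1 : (1 < k %/ d)%N by rewrite leq_divRL.
  rewrite ltn_divLR //; have := ltn_ceil k d_gt0; nia.
apply/existsP; exists [ffun x => Ordinal (block_lt x)].
apply/forallP=> x; apply/forallP=> y; apply/implyP=> xy; rewrite !ffunE.
apply/eqP=> -[same_block].
have /andP[dist_ge _] := g_col _ _ xy.
have /andP[gx_ge _] := g_nbr _ (valP x).
have /andP[gy_ge _] := g_nbr _ (valP y).
have := distn_lt_same_quotient d_gt0 same_block.
by rewrite ltnNge -!subzn // opprB addrA subrK dist_ge.
Qed.

(** A proper coloring is a (k,1)-coloring; taking two spare colors ensures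
    [2 <= k]. *)
Lemma circular_ratios_nonempty (R : realType) (G : sgraph) :
  (circular_ratios R G !=set0)%classic.
Proof.
have [n /existsP[f /forallP f_col]] := colorable_exists G.
exists (n.+2%:R / 1%:R), n.+2, 1%N; split => //.
exists (fun x => widen_ord (leq_trans (leqnSn n) (leqnSn n.+1)) (f x)) => x y.
move=> xy; have /forallP/(_ y) := f_col x; rewrite xy /= => /eqP fxy.
have {}fxy : nat_of_ord (f x) <> f y by move/val_inj.
move: (nat_of_ord (f x)) (nat_of_ord (f y)) (ltn_ord (f x)) (ltn_ord (f y)) fxy.
by move=> a b; lia.
Qed.

Theorem theorem8 (R : realType) (G : sgraph) (hG : connected_graph G) (u : G) :
  circular_chromatic_number R G >=
    (chromatic_number (induced (neighborhood u)))%:R + 1.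
Proof.
apply: lb_le_inf; first exact: circular_ratios_nonempty.
move=> _ [k [d [d_gt0 le_2dk Gkd ->]]].
have chi_le := chromatic_number_le (neighborhood_colorable u d_gt0 le_2dk Gkd).
have quo_gt1 : (1 < k %/ d)%N by rewrite leq_divRL.
rewrite ler_pdivlMr ?ltr0n // natr1 -natrM ler_nat -leq_divRL //; lia.
Qed.
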